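(* Let $X=\ell_\infty^{(2)}$ be the real space $\mathbb{R}^2$ with norm $\|(a,b)\|=\max\{|a|,|b|\}$. Then $\Phi_X^S(\delta)=\Phi_X(\delta)=\sqrt{2\delta}$ for all $\delta\in(0,2)$.
   Context: For a (real or complex) Banach space $X\neq\{0\}$, $B_X$ and $S_X$ denote its closed unit ball and unit sphere, $X^*$ its topological dual, and $\Pi(X):=\{(x,x^* )\in X\times X^* : \|x\|=\|x^*\|=x^*(x)=1\}$. The Bishop-Phelps-Bollobás modulus $\Phi_X:(0,2)\to[0,\infty)$ is defined as follows: $\Phi_X(\delta)$ is the infimum of those $\varepsilon>0$ such that for every $(x,x^* )\in B_X\times B_{X^*}$ with $\operatorname{Re} x^*(x)>1-\delta$ there is $(y,y^* )\in\Pi(X)$ with $\|x-y\|<\varepsilon$ and $\|x^*-y^*\|<\varepsilon$. The spherical Bishop-Phelps-Bollobás modulus $\Phi_X^S:(0,2)\to[0,\infty)$ is defined in the same way with $B_X\times B_{X^*}$ replaced by $S_X\times S_{X^*}$. *)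

(* Defs.v *)
From HB Require Import structures.
From mathcomp Require Import all_boot all_order all_algebra.
From mathcomp Require Import all_classical all_reals all_analysis.
Set Implicit Arguments.
Unset Strict Implicit.
Unset Printing Implicit Defensive.
Import Order.TTheory GRing.Theory Num.Theory.
Import numFieldNormedType.Exports.
Local Open Scope classical_set_scope.
Local Open Scope ring_scope.

(* Only real scalars are treated here, so Re (f x) is f x itself. *)
Section BishopPhelpsBollobas.
Context {R : realType} (X : completeNormedModType R).
Implicit Types (f g : {linear X -> R^o}) (x y : X).

Definition dual : set {linear X -> R^o} := [set f | continuous f].

Definition unit_ball : set X := [set x | `|x| <= 1].

Definition unit_sphere : set X := [set x | `|x| = 1].

(* The set is nonempty, and it is bounded above when h is linear and
   continuous; the value is meaningful only in that case. *)
Definition dual_norm (h : X -> R) : R := sup [set `|h x| | x in unit_ball].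

Definition dual_unit_ball : set {linear X -> R^o} :=
  [set f | dual f /\ dual_norm f <= 1].

Definition dual_unit_sphere : set {linear X -> R^o} :=
  [set f | dual f /\ dual_norm f = 1].

Definition duality_pairs : set (X * {linear X -> R^o}) :=
  [set p | [/\ dual p.2, `|p.1| = 1, dual_norm p.2 = 1 & p.2 p.1 = 1]].

Definition bpb_admissible (A : set X) (B : set {linear X -> R^o}) (delta : R) :
    set R :=
  [set eps | 0 < eps /\
    forall x f, A x -> B f -> f x > 1 - delta ->
      exists y g, [/\ duality_pairs (y, g), `|x - y| < eps
                    & dual_norm (f \- g) < eps]].

(* [inf] is 0 on the empty set, but when X is nonzero and 0 < delta < 2 both
   sets below contain every eps > 2: some (y, g) in [duality_pairs] exists, and
   the distances to it are at most 2. *)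
Definition bpb_modulus (delta : R) : R :=
  inf (bpb_admissible unit_ball dual_unit_ball delta).

Definition spherical_bpb_modulus (delta : R) : R :=
  inf (bpb_admissible unit_sphere dual_unit_sphere delta).

End BishopPhelpsBollobas.

HB.instance Definition _ (R : realType) (m n : nat) :=
  Complete.on 'M[R]_(m, n).

Definition linf2 (R : realType) : completeNormedModType R := 'rV[R]_2.

Lemma linf2_normE (R : realType) (v : 'rV[R]_2) :
  `|v : linf2 R| = Num.max `|v 0 0| `|v 0 1|.
Proof.
rewrite [LHS]mx_normrE.
apply/eqP; rewrite eq_le; apply/andP; split.
  apply/bigmax_leP; split; first by rewrite le_max normr_ge0.
  move=> [i j] _ /=; rewrite (ord1 i) le_max.
  by case: j => [[|[|//]] jlt]; apply/orP; [left|right];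
    rewrite le_eqVlt; apply/orP; left; apply/eqP; congr (`|v _ _|); exact: val_inj.
by rewrite ge_max; apply/andP; split; apply/bigmax_geP; right;
  [exists (0, 0)|exists (0, 1)].
Qed.

(* Main.v *)
(** Put t = sqrt (2 delta), so that delta = t^2 / 2, and identify the dual of
    l_infinity^2 with l_1^2.

    Lower bound: for e < t, take x = (1, 1 - e) and f = (1 - e/2, e/2), so that
    f(x) = 1 - e^2/2.  If |x - y| < e then y_2 < 1, so g attaining its norm at y
    must have g_2 <= 0, and this alone forces |f - g|_1 >= e.

    Upper bound: by symmetry assume f_1, f_2 >= 0 and x_2 <= x_1.  Then
    (1, 1), (1 - f_2, f_2) works if 1 - x_2 <= t; otherwise (1, x_2), (1, 0)
    works if 1 - x_1 <= t; otherwise (-1, -1), (-1, 0) works. *)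

Require Import Defs.
From HB Require Import structures.
From mathcomp Require Import all_boot all_order all_algebra.
From mathcomp Require Import all_classical all_reals all_analysis.
From mathcomp Require Import ring lra.
Import Order.TTheory GRing.Theory Num.Theory.
Import numFieldNormedType.Exports.
Local Open Scope classical_set_scope.
Local Open Scope ring_scope.

(** Coordinate form of a good approximating pair. Asking [|y1|, |y2| <= 1] is enough, since [g] of
    norm 1 with [g y = 1] forces [y] to have norm 1. Non-strict bounds by [t] give strict ones for
    every [e > t]. *)
Definition close_attaining_pair (R : realFieldType) (t x1 x2 f1 f2 : R) :=
  exists y1 y2 g1 g2 : R,
    [/\ [/\ `|y1| <= 1, `|y2| <= 1, `|g1| + `|g2| = 1
          & g1 * y1 + g2 * y2 = 1],
        `|x1 - y1| <= t, `|x2 - y2| <= t & `|f1 - g1| + `|f2 - g2| <= t].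

Lemma close_attaining_pairC (R : realFieldType) (t x1 x2 f1 f2 : R) :
  close_attaining_pair R t x1 x2 f1 f2 -> close_attaining_pair R t x2 x1 f2 f1.
Proof.
move=> [y1 [y2 [g1 [g2 [[? ? gN gy] ? ? ?]]]]].
exists y2, y1, g2, g1; split=> //; last by rewrite addrC.
by split=> //; rewrite addrC.
Qed.

(** Together with the swap this generates the symmetries of the square, which reduce everything to
    nonnegative coefficients of [f]. *)
Lemma close_attaining_pairN (R : realFieldType) (t x1 x2 f1 f2 : R) :
  close_attaining_pair R t (- x1) x2 (- f1) f2 ->
  close_attaining_pair R t x1 x2 f1 f2.
Proof.
move=> [y1 [y2 [g1 [g2 [[? ? ? ?] xy ? fg]]]]].
exists (- y1), y2, (- g1), g2; split=> //.
- by split; rewrite ?normrN ?mulrNN.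
- by rewrite -normrN opprD opprK.
- by rewrite -[`|f1 - _|]normrN opprD opprK.
Qed.

Lemma close_attaining_pair_nneg (R : realFieldType) (t x1 x2 p q : R) :
  0 < t < 2 -> `|x1| <= 1 -> `|x2| <= 1 -> 0 <= p -> 0 <= q -> p + q <= 1 ->
  p * x1 + q * x2 > 1 - t ^+ 2 / 2 -> close_attaining_pair R t x1 x2 p q.
Proof.
move=> /andP[t0 t2].
wlog x21 : x1 x2 p q / x2 <= x1 => [wlg x1N x2N p0 q0 pq fx|].
  have [x21|/ltW x12] := leP x2 x1; first exact: wlg.
  by apply: close_attaining_pairC; apply: wlg => //; lra.
rewrite !ler_norml => /andP[x1l x1u] /andP[x2l x2u] p0 q0 pq fx.
(* As [f x <= p + q], this bounds the defect [1 - (p + q)] by [t]. *)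
have t2_le : t ^+ 2 / 2 <= t by nra.
have [x2t|x2t] := leP (1 - x2) t.
  exists 1, 1, (1 - q), q; split.
  - by split; rewrite ?normr1 //; [rewrite !ger0_norm; lra|lra].
  - by rewrite ler_norml; lra.
  - by rewrite ler_norml; lra.
  - by rewrite subrr normr0 addr0 ler_norml; nra.
have [x1t|x1t] := leP (1 - x1) t.
  exists 1, x2, 1, 0; split.
  - by split; rewrite ?normr1 ?normr0 ?ler_norml; lra.
  - by rewrite ler_norml; lra.
  - by rewrite subrr normr0 ltW.
  (* From [f x <= 1 - q * (1 - x2)] and [1 - x2 > t]. *)
  - have q_lt : q < t / 2 by nra.
    rewrite subr0 (ger0_norm q0) ler0_norm; last lra.
    (* If [1 - p + q > t], then [f x <= p + q * (1 - t) < 1 - t + q * (2 - t) <= 1 - t ^+ 2 / 2]. *)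
    rewrite leNgt; apply/negP => gt_t; nra.
have fx_lt : 1 + (p + q) * (t - 1) < t ^+ 2 / 2 by nra.
(* If [t <= 1] then [f x <= (p + q) * (1 - t) <= 1 - t <= 1 - t ^+ 2 / 2]. *)
have t1 : 1 < t by rewrite ltNge; apply/negP => t1; nra.
(* Both coordinates of [x] are below [1 - t], hence within [2 - t < t] of -1. *)
exists (-1), (-1), (-1), 0; split.
- by split; rewrite ?normrN ?normr1 ?normr0; lra.
- by rewrite ler_norml; lra.
- by rewrite ler_norml; lra.
- rewrite subr0 opprK !ger0_norm; [|lra..].
  (* By [fx_lt], [p + q > t - 1] would give [(t - 1) ^+ 2 < t ^+ 2 / 2 - 1], that is
     [(t - 2) ^+ 2 < 0]. *)
  by rewrite leNgt; apply/negP => gt_t; nra.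
Qed.

Lemma close_attaining_pair_exists (R : realFieldType) (t x1 x2 f1 f2 : R) :
  0 < t < 2 -> `|x1| <= 1 -> `|x2| <= 1 -> `|f1| + `|f2| <= 1 ->
  f1 * x1 + f2 * x2 > 1 - t ^+ 2 / 2 -> close_attaining_pair R t x1 x2 f1 f2.
Proof.
move=> t02.
wlog f10 : x1 f1 / 0 <= f1 => [wlg x1N x2N fN fx|].
  have [f10|/ltW f10] := leP 0 f1; first exact: wlg.
  apply: close_attaining_pairN; apply: wlg; rewrite ?oppr_ge0 ?normrN //.
  by rewrite mulrNN.
wlog f20 : x2 f2 / 0 <= f2 => [wlg x1N x2N fN fx|].
  have [f20|/ltW f20] := leP 0 f2; first exact: wlg.
  apply/close_attaining_pairC/close_attaining_pairN/close_attaining_pairC.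
  by apply: wlg; rewrite ?oppr_ge0 ?normrN // mulrNN.
rewrite (ger0_norm f10) (ger0_norm f20) => *.
exact: close_attaining_pair_nneg.
Qed.

Lemma far_from_attaining_pairs (R : realFieldType) (e y1 y2 g1 g2 : R) :
  0 < e < 2 -> `|y1| <= 1 -> `|y2| <= 1 -> `|g1| + `|g2| = 1 ->
  g1 * y1 + g2 * y2 = 1 -> `|(1 - e) - y2| < e ->
  e <= `|(1 - e / 2) - g1| + `|e / 2 - g2|.
Proof.
move=> e02 y1N y2N gN gy; rewrite ltr_norml => /andP[y2l _].
have g1y1 : g1 * y1 <= `|g1|.
  by rewrite (le_trans (ler_norm _)) // normrM ler_piMr.
(* Here [y2 < 1], so [g2 > 0] would give [g y < |g1| + g2 = 1]. *)
have g20 : g2 <= 0.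
  rewrite leNgt; apply/negP => g20.
  by rewrite (gtr0_norm g20) in gN; nra.
rewrite (ler0_norm g20) in gN.
(* The two terms are at least [|g1| - 1 + e / 2] and [e / 2 + |g2|], and [|g1| + |g2| = 1]. *)
have : `|g1| - `|1 - e / 2| <= `|1 - e / 2 - g1|
  by rewrite [leRHS]distrC lerB_dist.
by rewrite [X in _ - X]ger0_norm 1?[`|e / 2 - g2|]ger0_norm; lra.
Qed.

Definition pair_row (R : realType) (a b : R) : linf2 R :=
  \row_(j < 2) (if j == 0 then a else b).

Definition pair_form (R : realType) (a b : R) (v : linf2 R) : R^o :=
  a * (v : 'rV[R]_2) 0 0 + b * (v : 'rV[R]_2) 0 1.

Lemma pair_form_linear (R : realType) (a b : R) : linear (pair_form R a b).
Proof. by move=> k u v; rewrite /pair_form !mxE /GRing.scale /=; ring. Qed.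

HB.instance Definition _ (R : realType) (a b : R) :=
  GRing.isLinear.Build R (linf2 R) R^o *:%R (pair_form R a b)
    (pair_form_linear R a b).

Lemma pair_form_continuous (R : realType) (a b : R) :
  continuous (pair_form R a b).
Proof.
have coordM c j : continuous (fun v : 'rV[R]_2 => c * v 0 j : R^o).
  move=> v; apply: (@continuousM R 'rV[R]_2 (fun=> c) (fun v => v 0 j)).
    exact: cst_continuous.
  exact: coord_continuous.
move=> v.
exact: (@continuousD R R^o 'rV[R]_2 _ _ v (coordM a 0 v) (coordM b 1 v)).
Qed.

Lemma linf2_formE (R : realType) (f : {linear linf2 R -> R^o}) :
  exists a b, f =1 pair_form R a b.
Proof.
exists (f ('e_0 : 'rV[R]_2)), (f ('e_1 : 'rV[R]_2)) => v.
have vE : v = v 0 0 *: ('e_0 : 'rV[R]_2) + v 0 1 *: ('e_1 : 'rV[R]_2).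
  rewrite [LHS]row_sum_delta !big_ord_recl big_ord0 addr0.
  by congr (v _ _ *: 'e__ + v _ _ *: 'e__); apply: val_inj.
by rewrite {1}vE linearD !linearZ /pair_form; congr (_ + _); exact: mulrC.
Qed.

(** Only pointwise equality is required of [h], so that this also covers the difference [f \- g].
    The supremum is attained at the vector of signs. *)
Lemma dual_norm_pair_form (R : realType) (h : linf2 R -> R) (a b : R) :
  h =1 pair_form R a b -> dual_norm h = `|a| + `|b|.
Proof.
move=> hE.
have ub : ubound [set `|h x| | x in @unit_ball R (linf2 R)] (`|a| + `|b|).
  move=> _ [v /= vN <-]; rewrite /unit_ball /= linf2_normE ge_max in vN.
  have /andP[v0 v1] := vN.
  by rewrite hE (le_trans (ler_normD _ _)) // !normrM lerD // ler_piMr.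
apply/eqP; rewrite eq_le; apply/andP; split.
  apply: ge_sup => //; exists `|h 0|, 0 => //.
  by rewrite /unit_ball /= normr0.
apply: ub_le_sup; first by exists (`|a| + `|b|).
exists (pair_row R (Num.sg a) (Num.sg b)).
  by rewrite /unit_ball /= linf2_normE !mxE /= ge_max !normr_sg !lern1 !leq_b1.
rewrite hE /pair_form !mxE /= !(mulrC _ (Num.sg _)) -!normrEsg.
by rewrite ger0_norm ?addr_ge0.
Qed.

Lemma inf_eq (R : realType) (S : set R) (t : R) :
  (forall e, t < e -> S e) -> (forall e, S e -> t <= e) -> inf S = t.
Proof.
move=> Sgt Sge; apply/eqP; rewrite eq_le; apply/andP; split.
  apply/ler_addgt0Pr => e e0; apply: ge_inf; first by exists t.
  by apply: Sgt; rewrite ltrDl.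
by apply: lb_le_inf => //; exists (t + 1); apply: Sgt; rewrite ltrDl.
Qed.

(** Pairs on the spheres are pairs in the balls, so an upper bound for the balls and a lower bound
    for the spheres settle both moduli. *)
Lemma bpb_admissible_sphere (R : realType) (X : completeNormedModType R)
    (delta e : R) :
  bpb_admissible (@unit_ball R X) (@dual_unit_ball R X) delta e ->
  bpb_admissible (@unit_sphere R X) (@dual_unit_sphere R X) delta e.
Proof.
move=> [e0 He]; split=> // x f xN [fc fN] fx; apply: He => //.
  by rewrite /unit_ball /= xN.
by split=> //; rewrite fN.
Qed.

Lemma linf2_ball_admissible (R : realType) (t e : R) :
  0 < t < 2 -> t < e ->
  bpb_admissible (@unit_ball R (linf2 R)) (@dual_unit_ball R (linf2 R))
    (t ^+ 2 / 2) e.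
Proof.
move=> t02 te; split=> [|x f].
  by case/andP: t02 => t0 _; exact: lt_trans te.
have [a [b fE]] := linf2_formE R f.
rewrite /unit_ball /= linf2_normE ge_max => /andP[x0 x1] [_].
rewrite (dual_norm_pair_form R _ a b fE) fE => abN fx.
have [y0 [y1 [g0 [g1 [[y0N y1N gN gy] xy0 xy1 fg]]]]] :=
  close_attaining_pair_exists R t _ _ _ _ t02 x0 x1 abN fx.
exists (pair_row R y0 y1), (pair_form R g0 g1); split.
(* [1 = g y <= (|g0| + |g1|) * |y| = |y|]. *)
- have yN : Num.max `|y0| `|y1| = 1.
    apply/eqP; rewrite eq_le ge_max y0N y1N /=.
    rewrite -gy -[leRHS]mul1r -gN mulrDl (le_trans (ler_norm _)) //.
    rewrite (le_trans (ler_normD _ _)) // !normrM.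
    by rewrite lerD // ler_wpM2l // le_max lexx ?orbT.
  split=> /=.
  + exact: pair_form_continuous.
  + by rewrite linf2_normE !mxE.
  + by rewrite (dual_norm_pair_form R _ g0 g1).
  + by rewrite /pair_form !mxE.
- by rewrite linf2_normE !mxE /= gt_max !(le_lt_trans _ te).
- rewrite (dual_norm_pair_form R _ (a - g0) (b - g1)) ?(le_lt_trans fg) // => v.
  by rewrite /= fE /pair_form; ring.
Qed.

Lemma linf2_sphere_admissible_ge (R : realType) (t e : R) :
  0 < t < 2 ->
  bpb_admissible (@unit_sphere R (linf2 R)) (@dual_unit_sphere R (linf2 R))
    (t ^+ 2 / 2) e -> t <= e.
Proof.
move=> /andP[t0 t2] [e0 He]; rewrite leNgt; apply/negP => et.
have e02 : 0 < e < 2 by rewrite e0 (lt_trans et).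
(* Built from [e] rather than [t]: the value [1 - e ^+ 2 / 2] strictly exceeds [1 - t ^+ 2 / 2]. *)
have [|||y [g []]] :=
  He (pair_row R 1 (1 - e)) (pair_form R (1 - e / 2) (e / 2)).
- rewrite /unit_sphere /= linf2_normE !mxE /= normr1; apply/max_idPl.
  by rewrite ler_norml; lra.
- split; first exact: pair_form_continuous.
  by rewrite (dual_norm_pair_form R _ (1 - e / 2) (e / 2)) // !ger0_norm; lra.
- by rewrite /= /pair_form !mxE /=; nra.
have [a [b gE]] := linf2_formE R g.
move=> [_ /= yN gN gy]; rewrite linf2_normE !mxE /= gt_max => /andP[_ xy1].
rewrite (dual_norm_pair_form R _ (1 - e / 2 - a) (e / 2 - b)); last first.
  by move=> v; rewrite /= gE /pair_form; ring.
rewrite (dual_norm_pair_form R _ a b gE) in gN; rewrite gE in gy.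
apply/negP; rewrite -leNgt.
have /andP[y0N y1N] : (`|y 0 0| <= 1) && (`|y 0 1| <= 1).
  by rewrite -ge_max -linf2_normE yN.
exact: (far_from_attaining_pairs R e (y 0 0) (y 0 1)).
Qed.

Theorem mainTheorem2 (R : realType) (delta : R) (hdelta : 0 < delta < 2) :
  spherical_bpb_modulus (linf2 R) delta = bpb_modulus (linf2 R) delta /\
  bpb_modulus (linf2 R) delta = Num.sqrt (2 * delta).
Proof.
set t := Num.sqrt (2 * delta).
have /andP[d0 d2] := hdelta.
have t0 : 0 < t by rewrite sqrtr_gt0; lra.
have tE : t ^+ 2 = 2 * delta by rewrite sqr_sqrtr //; lra.
have t02 : 0 < t < 2 by rewrite t0 /= ltNge; apply/negP => t2; nra.
have -> : delta = t ^+ 2 / 2 by rewrite tE; field.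
have ball e : t < e -> _ := linf2_ball_admissible R t e t02.
have sphere e := linf2_sphere_admissible_ge R t e t02.
have -> : bpb_modulus (linf2 R) (t ^+ 2 / 2) = t.
  apply: inf_eq => // e /bpb_admissible_sphere; exact: sphere.
split=> //; apply: inf_eq => [e te|//].
by apply: bpb_admissible_sphere; exact: ball.
Qed.
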